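(* Let $n,m,j\in\mathbb{Z}^+$ with $n\geq 2$, $m\ge 3$, and $1\le j<\frac{m}{2}$, and let $G(m,j)$ be the generalized Petersen graph. If $n\notin\{2,4\}$, then $\chi_n(G(m,j)) = \chi(G(m,j))$. If $n\in\{2,4\}$, $2\mid m$ and $2\nmid j$, then $\chi_n(G(m,j)) = \chi(G(m,j))=2$. If $n\in\{2,4\}$ and it is not the case that ($2\mid m$ and $2\nmid j$), then $3 \leq \chi_n(G(m,j)) \leq 6$.
   Context: $G(m,j)$ has vertex set $\{v_i,u_i : 0\le i<m\}$ and edges $v_iv_{i+1}$, $v_iu_i$, $u_iu_{i+j}$ for $0\le i<m$, indices mod $m$. For a graph $G=(V,E)$, a $\mathbb{Z}$-labeling is a map $\ell:V\to\mathbb{Z}$; its order is the size of its range; it is proper if adjacent vertices get different labels; $\chi(G)$ is the minimum order of a proper labeling. $N[v]$ is the closed neighborhood of $v$. A closed coloring with nonzero remainders mod $n$ is a labeling with $\sum_{w\in N[v]}\ell(w)\not\equiv 0 \pmod n$ for all $v\in V$. $\chi_n(G)$ denotes the minimum order of a proper closed coloring with nonzero remainders mod $n$ of $G$. *)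

(* Defs.v *)
From mathcomp Require Import all_boot all_order all_algebra.
From mathcomp Require Import boolp classical_sets.

Set Implicit Arguments.
Unset Strict Implicit.
Unset Printing Implicit Defensive.

(* Value 0 when no natural number satisfies P. *)
Definition least (P : nat -> Prop) : nat :=
  xget 0 [set k | P k /\ forall k', P k' -> k <= k']%classic.

Lemma leastP (P : nat -> Prop) (k0 : nat) :
  P k0 -> P (least P) /\ forall k, P k -> least P <= k.
Proof.
move=> Pk0; rewrite /least; case: xgetP => [k -> //|noleast].
have exP : exists k, `[< P k >] by exists k0; apply/asboolP.
case: (ex_minnP exP) => k /asboolP Pk mink.
by case: (noleast k); split=> // k' Pk'; apply: mink; apply/asboolP.
Qed.

(* A graph on V is given by its adjacency relation e, which is symmetric and
   irreflexive; see [gpetersen_sym] and [gpetersen_irr]. *)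

Definition proper_labeling (V : finType) (e : rel V) (l : V -> int) : Prop :=
  forall x y : V, e x y -> l x <> l y.

Definition order_of (V : finType) (l : V -> int) : nat :=
  size (undup (codom l)).

Definition closed_nbhd (V : finType) (e : rel V) (v : V) : {set V} :=
  [set w | (w == v) || e v w].

Definition closed_nonzero (n : nat) (V : finType) (e : rel V) (l : V -> int) :
    Prop :=
  forall v : V, (\sum_(w in closed_nbhd e v) l w <> 0 %[mod n])%R%Z.

Definition chi (V : finType) (e : rel V) : nat :=
  least (fun k => exists l : V -> int, proper_labeling e l /\ order_of l = k).

Definition chi_mod (n : nat) (V : finType) (e : rel V) : nat :=
  least (fun k => exists l : V -> int,
    [/\ proper_labeling e l, closed_nonzero n e l & order_of l = k]).

(* On a nonempty graph the orders are positive, so the default 0 of [least]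
   is never confused with the order of a labeling. *)
Lemma order_of_gt0 (V : finType) (l : V -> int) (v : V) : 0 < order_of l.
Proof.
have : l v \in undup (codom l) by rewrite mem_undup codom_f.
by rewrite /order_of; case: (undup _).
Qed.

(* inl i is v_i and inr i is u_i. *)
Definition gpetersen (m j : nat) : rel ('I_m + 'I_m) := fun x y =>
  match x, y with
  | inl a, inl b => (b == (a + 1) %% m :> nat) || (a == (b + 1) %% m :> nat)
  | inl a, inr b => a == b
  | inr a, inl b => a == b
  | inr a, inr b => (b == (a + j) %% m :> nat) || (a == (b + j) %% m :> nat)
  end.
Arguments gpetersen : clear implicits.

Lemma gpetersen_sym (m j : nat) : symmetric (gpetersen m j).
Proof. by move=> [a|a] [b|b] //=; rewrite orbC. Qed.

Lemma gpetersen_irr (m j : nat) :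
  1 <= j -> 2 * j < m -> irreflexive (gpetersen m j).
Proof.
move=> j0 jm.
have H d (a : 'I_m) : 0 < d -> d < m -> (a == (a + d) %% m :> nat) = false.
  move=> d0 dm; apply/negP => /eqP E.
  have : a + d == a + 0 %[mod m] by rewrite addn0 -E modn_small.
  by rewrite eqn_modDl mod0n modn_small // eqn0Ngt d0.
have jm1 : j < m by apply: leq_ltn_trans jm; rewrite leq_pmull.
by move=> [a|a] /=; rewrite orbb H // (leq_ltn_trans j0 jm1).
Qed.

(* Main.v *)
Require Import Defs.
From mathcomp Require Import all_boot all_order all_algebra.
From mathcomp Require Import zify ring.

Set Implicit Arguments.
Unset Strict Implicit.
Unset Printing Implicit Defensive.

Import Order.TTheory GRing.Theory Num.Theory.

(** Every closed neighborhood of the cubic graph G(m,j) has 4 elements. If n does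
    not divide 4, replacing a proper labeling l by 1 + n * l makes every closed
    sum congruent to 4. If n is even, it is enough that closed sums be odd. A
    proper 0/1-labeling has this property, its closed sums being 0 + 3 * 1 or
    1 + 3 * 0. For non-bipartite G(m,j), label the v_i by multiples of n and the
    u_i by integers congruent to 1 mod n: the closed sums are then 1 or 3 mod n.
    Three values on each side suffice, since both sides are disjoint unions of
    cycles; hence the bound 6. *)

(** * Orders of labelings and closed sums in an arbitrary graph *)

Section LeastOrders.

Variables (V : finType) (e : rel V).

Lemma order_of_comp_inj (f : int -> int) (l : V -> int) :
  injective f -> order_of (f \o l) = order_of l.
Proof.
by move=> injf; rewrite /order_of codomE map_comp -codomE undup_map_inj ?size_map.
Qed.

Lemma chi_le (l : V -> int) : proper_labeling e l -> chi e <= order_of l.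
Proof. by move=> Pl; apply: (proj2 (@leastP _ (order_of l) _)); exists l. Qed.

Lemma chi_witness : irreflexive e ->
  exists l : V -> int, proper_labeling e l /\ order_of l = chi e.
Proof.
(* An injective numbering is proper in the absence of loops, so [least] does not fall back on its
   default 0. *)
move=> irr; pose l (x : V) := Posz (enum_rank x).
have Pl : proper_labeling e l.
  move=> x y exy [] /val_inj/enum_rank_inj xy.
  by rewrite xy irr in exy.
apply: (proj1 (@leastP (fun k => exists l : V -> int,
  proper_labeling e l /\ order_of l = k) (order_of l) _)).
by exists l.
Qed.

Variable n : nat.

Lemma chi_mod_le (l : V -> int) :
  proper_labeling e l -> closed_nonzero n e l -> chi_mod n e <= order_of l.
Proof. by move=> Pl Cl; apply: (proj2 (@leastP _ (order_of l) _)); exists l. Qed.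

Lemma chi_mod_witness (l0 : V -> int) :
  proper_labeling e l0 -> closed_nonzero n e l0 ->
  exists l : V -> int,
    [/\ proper_labeling e l, closed_nonzero n e l & order_of l = chi_mod n e].
Proof.
move=> Pl Cl; apply: (proj1 (@leastP (fun k => exists l : V -> int,
  [/\ proper_labeling e l, closed_nonzero n e l & order_of l = k])
  (order_of l0) _)).
by exists l0.
Qed.

Lemma order_of_le_seq (l : V -> int) (s : seq int) :
  (forall x, l x \in s) -> order_of l <= size s.
Proof.
move=> ls; apply: uniq_leq_size; first exact: undup_uniq.
by move=> _ /[!mem_undup] /codomP[x ->].
Qed.

Lemma order_of_gt1 (l : V -> int) (x y : V) :
  proper_labeling e l -> e x y -> 1 < order_of l.
Proof.
move=> Pl exy; have /eqP lxy := Pl _ _ exy.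
apply: (@uniq_leq_size _ [:: l x; l y]); first by rewrite /= inE lxy.
by move=> z; rewrite !inE mem_undup => /orP[]/eqP->; apply: codom_f.
Qed.

(** [l x] and [l y] differ, so if neither were [l z] there would be three labels. *)
Lemma two_labels (l : V -> int) (z x y : V) :
  proper_labeling e l -> order_of l <= 2 -> e x y ->
  (l y == l z) = ~~ (l x == l z).
Proof.
move=> Pl ord2 exy; have /eqP lxy := Pl _ _ exy.
have [<-|nxz] := eqVneq (l x) (l z); first by rewrite eq_sym (negbTE lxy).
apply: contraTT ord2 => nyz; rewrite -ltnNge.
apply: (@uniq_leq_size _ [:: l x; l y; l z]).
  by rewrite /= !inE negb_or lxy nxz nyz.
by move=> t; rewrite !inE mem_undup => /or3P[]/eqP->; apply: codom_f.
Qed.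

Lemma closed_sum (F : V -> int) (v : V) : irreflexive e ->
  (\sum_(w in closed_nbhd e v) F w = F v + \sum_(w | e v w) F w)%R.
Proof.
move=> irr; rewrite (bigD1 v) /= ?inE ?eqxx //; congr (_ + _)%R.
apply: eq_bigl => w; rewrite inE.
by have [->|_] := eqVneq w v; rewrite ?irr ?andbT.
Qed.

Lemma sum_eqmodz (d : int) (P : pred V) (F G : V -> int) :
  (forall w, F w = G w %[mod d])%Z ->
  (\sum_(w | P w) F w = \sum_(w | P w) G w %[mod d])%Z.
Proof.
move=> FG; apply/eqP; rewrite eqz_mod_dvd -sumrB.
by apply: rpred_sum => w _; rewrite -eqz_mod_dvd FG.
Qed.

End LeastOrders.

(** * Circulant graphs: residues mod m joined at distance d *)

Section Circulant.

Variables m d : nat.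
Hypotheses (d_gt0 : 0 < d) (d_lt : 2 * d < m).

Lemma modn_add_lt (a b : nat) : a < m -> b < m ->
  (a + b) %% m = if a + b < m then a + b else a + b - m.
Proof.
move=> am bm; case: ltnP => ab; first exact: modn_small.
by rewrite -{1}(subnK ab) modnDr modn_small //; lia.
Qed.

Lemma circulant_sum_const (c : int) (a : 'I_m) :
  (\sum_(b < m | (b == ((a + d) %% m)%N :> nat) || (a == ((b + d) %% m)%N :> nat)) c
   = 2 * c)%R.
Proof.
have dm : d < m by lia.
have am := ltn_ord a.
have m_gt0 : 0 < m by lia.
pose s : 'I_m := Ordinal (ltn_pmod (a + d) m_gt0).
(* This is [a - d] modulo [m]; it differs from [a + d] because [0 < 2 * d < m]. *)
pose p : 'I_m := Ordinal (ltn_pmod (a + (m - d)) m_gt0).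
have mdm : m - d < m by lia.
have nsp : s != p.
  apply/eqP => /(congr1 val) /=.
  by rewrite !modn_add_lt //; do 2 case: ltnP => ?; lia.
transitivity (\sum_(b in [set s; p]) c)%R; last first.
  by rewrite sumr_const cards2 nsp mulr_natl.
apply: eq_bigl => b; rewrite !inE -!val_eqE /=; congr (_ || _).
have bm := ltn_ord b.
by rewrite !modn_add_lt //; do 2 case: ltnP => ?; apply/eqP/eqP; lia.
Qed.

(* Blocks of length d alternate between 0 and 1, and the last d residues, which
   are the ones whose successor wraps around into the first block, get 2. *)
Definition circulant_color (i : nat) : nat :=
  if m - d <= i then 2 else odd (i %/ d).

Lemma circulant_color_lt3 (i : nat) : circulant_color i < 3.
Proof. by rewrite /circulant_color; case: ifP => // _; case: odd. Qed.

Lemma circulant_color_proper (i : nat) : i < m ->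
  circulant_color ((i + d) %% m) <> circulant_color i.
Proof.
move=> im; rewrite modn_add_lt //; last by lia.
rewrite /circulant_color; case: ltnP => idm.
  rewrite (_ : (m - d <= i) = false); last by lia.
  case: leqP => _; first by case: odd.
  by rewrite divnDr ?divnn ?d_gt0 ?addn1 //=; case: odd.
rewrite (_ : (m - d <= i) = true); last by lia.
(* The wrapped index satisfies [i + d - m < d < m - d], so its color is not 2. *)
rewrite (_ : (m - d <= _) = false); last by lia.
by case: odd.
Qed.

End Circulant.

(** * Labelings of generalized Petersen graphs *)

Section GeneralizedPetersen.

Variables m j : nat.
Hypotheses (m_ge3 : 3 <= m) (j_gt0 : 1 <= j) (j_lt : 2 * j < m).

Local Notation G := (gpetersen m j).

Let irrG : irreflexive G := gpetersen_irr j_gt0 j_lt.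

(** Besides [v] there are two neighbors on its own side, a circulant of distance 1 or [j], and one
    across the spoke. *)
Lemma gpetersen_sum_const (a b : int) (v : 'I_m + 'I_m) :
  (\sum_(w in closed_nbhd G v) (if w is inl _ then a else b) =
   if v is inl _ then 3 * a + b else a + 3 * b)%R.
Proof.
have m_gt2 : 2 * 1 < m by [].
rewrite closed_sum // big_sumType /=.
case: v => i /=; rewrite circulant_sum_const // (big_pred1 i).
- by ring.
- by move=> k; rewrite /= eq_sym.
- by ring.
- by move=> k; rewrite /= eq_sym.
Qed.

Lemma gpetersen_degree (v : 'I_m + 'I_m) (c : int) :
  (\sum_(w | G v w) c = 3 * c)%R.
Proof.
have := closed_sum (fun=> c) v irrG.
(* The constant is split by sides so that [gpetersen_sum_const] applies. *)
rewrite (eq_bigr (fun w : 'I_m + 'I_m => if w is inl _ then c else c)); last first.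
  by case.
rewrite gpetersen_sum_const => H.
apply: (addrI c); rewrite -H.
by case: v {H} => _; ring.
Qed.

Lemma chi_mod_eq_chi (n : nat) : ~~ (n %| 4) -> 0 < n -> chi_mod n G = chi G.
Proof.
move=> n4 n_gt0; have [l [Pl ordl]] := chi_witness irrG.
pose f (z : int) := (1 + n%:Z * z)%R.
have injf : injective f.
  move=> x y /addrI; apply: mulfI; by rewrite eqz_nat -lt0n.
have Pf : proper_labeling G (f \o l) by move=> x y exy /injf; apply: Pl.
have Cf : closed_nonzero n G (f \o l).
  move=> v.
  rewrite (@sum_eqmodz _ _ _ _ (fun w => if w is inl _ then 1 else 1)%R).
    rewrite gpetersen_sum_const mod0z => H; case/negP: n4.
    by have: (n%:Z %| 4%:Z)%Z; [apply/dvdz_mod0P; case: v H|].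
  by move=> w; rewrite /f /= mulrC addrC modzMDl; case: w.
(* The injective [f] keeps the order, giving one inequality; the other holds since admissible
   labelings are proper. *)
apply/eqP; rewrite eqn_leq -{1}ordl -(order_of_comp_inj l injf) chi_mod_le //=.
by have [l' [Pl' _ <-]] := chi_mod_witness Pf Cf; apply: chi_le.
Qed.

Let v0 : 'I_m := Ordinal (leq_trans (isT : 0 < 3) m_ge3).
Let v1 : 'I_m := Ordinal (leq_trans (isT : 1 < 3) m_ge3).

Let edge01 : G (inl v0) (inl v1).
Proof. by rewrite /= add0n modn_small ?eqxx // (leq_trans _ m_ge3). Qed.

Lemma chi_gpetersen_gt1 : 1 < chi G.
Proof. by have [l [Pl <-]] := chi_witness irrG; apply: order_of_gt1 Pl edge01. Qed.

(* The outer cycle has length m, and u_0 v_0 v_1 ... v_j u_j is a cycle of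
   length j + 3. *)
Lemma gpetersen_bipartite (l : 'I_m + 'I_m -> int) :
  proper_labeling G l -> order_of l <= 2 -> ~~ odd m /\ odd j.
Proof.
(* [P] marks the vertices labeled like v_0 and flips along each edge, so it detects parity on the
   cycles. *)
move=> Pl ord2; pose P x := l x == l (inl v0).
have alt x y : G x y -> P y = ~~ P x by apply: two_labels.
have Pv (i : 'I_m) : P (inl i) = ~~ odd i.
  case: i => i; elim: i => [|i IH] im.
    by rewrite /P /= (_ : Ordinal im = v0) ?eqxx //; apply: val_inj.
  rewrite /= (alt (inl (Ordinal (ltnW im)))) ?IH //=.
  by rewrite addn1 modn_small ?eqxx.
have jm : j < m by lia.
have m1m : m.-1 < m by lia.
split.
  have := alt (inl (Ordinal m1m)) (inl v0).
  rewrite !Pv /= addn1 prednK ?modnn ?eqxx; last by lia.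
  by move=> /(_ isT); rewrite negbK => /esym; rewrite -subn1 oddB; [case: odd|lia].
have := alt (inr v0) (inr (Ordinal jm)).
rewrite /= add0n modn_small // eqxx => /(_ isT).
have Pu (i : 'I_m) : P (inr i) = ~~ P (inl i) by apply: alt; rewrite /= eqxx.
rewrite !Pu.
by rewrite !Pv /= !negbK.
Qed.

(** A multiple of the even [n] is even; [s] is a simpler representative of [l] modulo [n]. *)
Lemma odd_closed_nonzero (n : nat) (l s : 'I_m + 'I_m -> int) :
    2 %| n -> (forall w, l w = s w %[mod n])%Z ->
    (forall v, ~~ (2 %| (\sum_(w in closed_nbhd G v) s w)%R)%Z) ->
  closed_nonzero n G l.
Proof.
move=> n2 ls odds v; rewrite (sum_eqmodz _ ls) mod0z => /dvdz_mod0P ns.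
by case/negP: (odds v); apply: dvdz_trans ns.
Qed.

Lemma chi_mod_bipartite (n : nat) : 2 %| n -> ~~ odd m -> odd j ->
  chi_mod n G = 2 /\ chi G = 2.
Proof.
move=> n2 m_even j_odd.
pose b (x : 'I_m + 'I_m) := match x with inl i => odd i | inr i => ~~ odd i end.
(* Reduction modulo the even [m] keeps parity, and the shifts 1 and [j] are odd. *)
have flip x y : G x y -> b y = ~~ b x.
  case: x y => [x|x] [y|y] //=.
  - by case/orP => /eqP->; rewrite odd_mod ?(negbTE m_even) // oddD /= addbT ?negbK.
  - by move/eqP->.
  - by move/eqP->; rewrite negbK.
  - by case/orP => /eqP->; rewrite odd_mod ?(negbTE m_even) // oddD j_odd /= addbT ?negbK.
pose l x : int := b x.
have Pl : proper_labeling G l by move=> x y /flip; rewrite /l => ->; case: (b x).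
have Cl : closed_nonzero n G l.
  apply: (@odd_closed_nonzero _ _ l) => // v; rewrite closed_sum //.
  rewrite (eq_bigr (fun=> ~~ b v : int)) => [|w /flip bw]; last by rewrite /l bw.
  by rewrite gpetersen_degree /l; case: (b v).
have ord2 : order_of l <= 2.
  by apply: (@order_of_le_seq _ _ [:: 0; 1]%R) => x; rewrite /l; case: (b x).
have [l' [Pl' _ ordl']] := chi_mod_witness Pl Cl.
(* Both numbers are squeezed: [1 < chi <= chi_mod <= order_of l <= 2]. *)
have le1 := chi_le Pl'; have le2 := chi_mod_le Pl Cl; have := chi_gpetersen_gt1.
by lia.
Qed.

(** An explicit labeling is given, since it also shows that the minimum [chi_mod] is attained. *)
Lemma chi_mod_le6 (n : nat) : 2 %| n -> 0 < n ->
  exists l : 'I_m + 'I_m -> int,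
    [/\ proper_labeling G l, closed_nonzero n G l & order_of l <= 6].
Proof.
move=> n2 n_gt0.
pose c (x : 'I_m + 'I_m) :=
  match x with inl i => circulant_color m 1 i | inr i => circulant_color m j i end.
pose s (x : 'I_m + 'I_m) : int := if x is inl _ then 0%R else 1%R.
pose l (x : 'I_m + 'I_m) : int := (n%:Z * c x + s x)%R.
have n_neq0 : (n%:Z != 0)%R by rewrite eqz_nat -lt0n.
have ls w : (l w = s w %[mod n])%Z by rewrite /l mulrC modzMDl.
exists l; split.
- move=> x y Gxy lxy.
  (* Being positive and even, [n] is at least 2, so residues mod [n] tell the sides apart and the
     edge lies within one side. *)
  have sxy : s x = s y.
    have : (s x = s y %[mod n])%Z by rewrite -!ls lxy.
    rewrite /s; case: (n) n_gt0 n2 => [|[|k]] // _ _.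
    by case: (x) => ?; case: (y) => ?.
  move: lxy; rewrite /l sxy => /addIr /(mulfI n_neq0) [].
  case: x y Gxy sxy => [x|x] [y|y] //= /orP[]/eqP-> _;
    [move/esym| |move/esym|]; apply: circulant_color_proper; rewrite ?ltn_ord //.
- apply: (@odd_closed_nonzero _ _ s) => // v.
  by rewrite gpetersen_sum_const; case: v.
- apply: (@order_of_le_seq _ _
    [seq n%:Z * k%:Z + t | k <- [:: 0; 1; 2]%N, t <- [:: 0; 1]]%R) => x.
  apply: (@allpairs_f _ _ _ (fun k t => n%:Z * k%:Z + t)%R).
    have : c x < 3 by case: (x) => i; apply: circulant_color_lt3.
    by case: (c x) => [|[|[|]]].
  by case: x.
Qed.

End GeneralizedPetersen.

Theorem theorem4p9 (n m j : nat) (hn : 2 <= n) (hm : 3 <= m)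
    (hj1 : 1 <= j) (hj2 : 2 * j < m) :
  [/\ n \notin [:: 2; 4] ->
        chi_mod n (gpetersen m j) = chi (gpetersen m j),
      n \in [:: 2; 4] -> 2 %| m /\ ~~ (2 %| j) ->
        chi_mod n (gpetersen m j) = chi (gpetersen m j) /\
        chi (gpetersen m j) = 2
    & n \in [:: 2; 4] -> ~ (2 %| m /\ ~~ (2 %| j)) ->
        3 <= chi_mod n (gpetersen m j) <= 6].
Proof.
have n_gt0 : 0 < n by apply: ltnW.
have even24 : n \in [:: 2; 4] -> 2 %| n by rewrite !inE => /orP[]/eqP->.
split.
- move=> n24; apply: chi_mod_eq_chi => //; apply: contra n24 => n4.
  (* The divisors of 4 that are at least 2 are 2 and 4. *)
  have n_le4 : n <= 4 by apply: dvdn_leq n4.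
  by case: n hn n4 n_le4 {even24 n_gt0} => [|[|[|[|[|]]]]].
- move=> /even24 n2; rewrite !dvdn2 negbK => -[m_even j_odd].
  by have [-> ->] := chi_mod_bipartite hm hj1 hj2 n2 m_even j_odd.
- move=> /even24 n2 nbip; have [l [Pl Cl ord6]] := chi_mod_le6 hm hj1 hj2 n2 n_gt0.
  rewrite (leq_trans (chi_mod_le Pl Cl) ord6) andbT ltnNge.
  have [l' [Pl' _ <-]] := chi_mod_witness Pl Cl.
  (* An optimal labeling with at most two values would force the excluded parities. *)
  apply/negP => ord2; apply: nbip.
  by rewrite !dvdn2 negbK; apply: gpetersen_bipartite Pl' ord2.
Qed.
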